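(* Let $S$ be a finite tree with at least two vertices. Let $t_{\star} \in \mathbb{N}$ be such that $t_{\star} > |S|$ and $t_{\star} > 3$. Then $$\lim_{n \to \infty} \mathrm{TV}\left( \mathrm{CPA}(n, t_{\star}, S), \mathrm{PA}(n, S)^{\otimes 2} \right) > 0.$$
   Context: Trees are regarded as unlabeled (up to isomorphism); $|S|$ is the number of vertices of $S$. Preferential attachment (PA) trees with seed tree $S$ (with at least two vertices): $T_{|S|} = S$, and given $T_t$, the tree $T_{t+1}$ is obtained by adding one new vertex and one edge joining it to an existing vertex of $T_t$ chosen with probability proportional to its degree in $T_t$. $\mathrm{PA}(n,S)$ denotes the law of the $n$-vertex tree $T_n$. For $t_\star \ge |S|$ and $n \geq t_{\star}$, $\mathrm{CPA}(n, t_{\star}, S)$ is the law of the pair $(T_n^1, T_n^2)$, where $T_t^1 = T_t^2 =: T_t$ for $|S| \leq t \leq t_{\star}$ is grown from $S$ by PA, and conditionally on $T_{t_{\star}}$ the sequences $\{T_t^1\}_{t \geq t_{\star}}$, $\{T_t^2\}_{t \geq t_{\star}}$ are independent PA sequences started from $T_{t_{\star}}$. $\mathrm{PA}(n,S)^{\otimes 2}$ is the law of two independent samples of $\mathrm{PA}(n,S)$. $\mathrm{TV}(P,Q) = \sup_A |P(A) - Q(A)|$; the total variation distance above is non-increasing in $n$, so the limit exists. *)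

(* Defs.v *)
From HB Require Import structures.
From mathcomp Require Import all_boot all_order all_algebra all_fingroup.
From mathcomp Require Import all_classical all_reals all_analysis.

Set Implicit Arguments.
Unset Strict Implicit.
Unset Printing Implicit Defensive.

Import Order.TTheory GRing.Theory Num.Theory.
Import numFieldNormedType.Exports.

Local Open Scope ring_scope.

(* Adjacency matrix of a graph with vertex set 'I_n. *)
Definition graph (n : nat) : finType := 'M[bool]_n.

Definition adj n (G : graph n) : rel 'I_n := fun x y => G x y.

(* For a symmetric relation, [:: x; y] is a ucycle whenever xy is an edge; the
   cycles of the graph are the ucycles with at least three vertices. *)
Definition is_tree n (G : graph n) : Prop :=
  [/\ (0 < n)%N,
      symmetric (adj G),
      irreflexive (adj G),
      (forall x y : 'I_n, connect (adj G) x y)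
    & (forall c : seq 'I_n, ucycle (adj G) c -> (size c <= 2)%N)].

Definition deg n (G : graph n) (v : 'I_n) : nat := #|[set w | adj G v w]|.

(* The new vertex is ord_max; lift ord_max keeps the values of old vertices. *)
Definition attach n (G : graph n) (v : 'I_n) : graph n.+1 :=
  \matrix_(i, j)
    match unlift ord_max i, unlift ord_max j with
    | Some x, Some y => G x y
    | Some x, None => x == v
    | None, Some y => y == v
    | None, None => false
    end.

Definition iso n (G H : graph n) : bool :=
  [exists s : 'S_n, [forall x, forall y, adj H (s x) (s y) == adj G x y]].

(* An unlabeled graph is an isomorphism class of labeled ones. *)
Definition ugraph (n : nat) : finType := {set graph n}.

Definition unlabel n (G : graph n) : ugraph n := [set H | iso G H].

(* Laws on a finite type are given by their mass functions. *)
Section Laws.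
Variable R : realType.

Definition prob (T : finType) (P : T -> R) (A : {set T}) : R :=
  \sum_(x in A) P x.

Definition pushforward (T U : finType) (f : T -> U) (P : T -> R) (y : U) : R :=
  prob P [set x | f x == y].

Definition prod_law (T U : finType) (P : T -> R) (Q : U -> R) (p : T * U) : R :=
  P p.1 * Q p.2.

(* The supremum over events is a maximum, the type being finite. *)
Definition TV (T : finType) (P Q : T -> R) : R :=
  \big[Num.max/0]_(A : {set T}) `|prob P A - prob Q A|.

Definition pa_step n (G : graph n) (H : graph n.+1) : R :=
  \sum_(v : 'I_n | attach G v == H) (deg G v)%:R / (\sum_(w : 'I_n) deg G w)%:R.

(* lPA S n is the law of the labeled graph at time n for the process equal to
   S at time m; Tagged compares graphs whose numbers of vertices m and n are
   not syntactically equal.  It is the zero function for n < m. *)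
Fixpoint lPA m (S : graph m) (n : nat) : graph n -> R :=
  match n return graph n -> R with
  | 0 => fun T => (Tagged graph T == Tagged graph S)%:R
  | n'.+1 => fun T =>
      if (m <= n')%N then \sum_(T' : graph n') lPA S T' * pa_step T' T
      else (Tagged graph T == Tagged graph S)%:R
  end.

Definition lCPA m (S : graph m) (n tstar : nat) (T : graph n * graph n) : R :=
  \sum_(G : graph tstar) lPA S G * (lPA G T.1 * lPA G T.2).

Definition PA (n : nat) m (S : graph m) : ugraph n -> R :=
  pushforward (@unlabel n) (@lPA m S n).

Definition CPA (n tstar : nat) m (S : graph m) : ugraph n * ugraph n -> R :=
  pushforward (fun T : graph n * graph n => (unlabel T.1, unlabel T.2))
    (@lCPA m S n tstar).

End Laws.

Arguments PA R n {m} S _.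
Arguments CPA R n tstar {m} S _.

(* Main.v *)
Require Import Defs.
From mathcomp Require Import all_boot all_order all_algebra all_fingroup.
From mathcomp Require Import all_classical all_reals all_analysis.
From mathcomp Require Import ring lra.

Set Implicit Arguments.
Unset Strict Implicit.
Unset Printing Implicit Defensive.

Import Order.TTheory GRing.Theory Num.Theory.
Import numFieldNormedType.Exports.

Local Open Scope ring_scope.

(** Why the total variation distance stays away from zero.

    Let Y be the sum of the squared degrees of a graph and D the sum of its
    degrees.  Attaching a leaf to a vertex of degree d turns Y into
    Y + 2 d + 2 and D into D + 2, and d is chosen with probability d / D, so
    the mean of the new Y is Y (D + 2) / D + 2.  Hence
    mart = Y / D - (2 / D + 2 / (D - 2) + ...)
    is a martingale of the preferential attachment chain, and it depends on
    the unlabeled graph only.  It is bounded in L^2: its increments have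
    conditional variance of order (sum of d^3) / D^3, and the sum of cubes,
    which grows like D^(3/2), can be absorbed into an explicit nonnegative
    supermartingale [potential] dominating mart^2 ([avg_potential]).

    Center mart so that it vanishes at the seed S.  For the product law, the
    product of mart over the two trees has mean zero at every time n.  For the
    coupled law, the two trees are independent given the common tree G at
    time tstar, so this mean is the expectation of mart(G)^2, the variance at
    time tstar.  That variance is positive: some tree that occurs at time
    tstar - 1 has two vertices of different positive degrees
    ([reach_irregular]), and attaching the last vertex to one or to the other
    gives different values of mart.  So a test function with second moments
    bounded uniformly in n separates the means of the two laws by a constant,
    which bounds the total variation distance from below
    ([second_moment_le_TV], [CPA_TV_lower_bound]).

    The limit exists because the attachment step depends on unlabeled graphs
    only, so that each pair of laws at time n + 1 is the image of the pair at
    time n under one Markov kernel, which cannot increase the distance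
    ([TV_succ]). *)

(** * Degrees and isomorphisms under attachment *)

Definition totdeg n (G : graph n) : nat := (\sum_v deg G v)%N.

Lemma deg_sum n (G : graph n) v : deg G v = (\sum_w G v w)%N.
Proof.
rewrite /deg -sum1dep_card big_mkcond /=.
by apply: eq_bigr => w _; rewrite /adj; case: (G v w).
Qed.

Section Attach.
Variables (n : nat) (G : graph n) (v : 'I_n).

Lemma deg_attach_old w :
  deg (attach G v) (lift ord_max w) = (deg G w + (w == v))%N.
Proof.
rewrite !deg_sum (bigD1_ord ord_max) //= addnC /attach; congr (_ + _)%N.
  by apply: eq_bigr => y _; rewrite mxE !liftK.
by rewrite mxE liftK unlift_none.
Qed.

Lemma deg_attach_new : deg (attach G v) ord_max = 1%N.
Proof.
rewrite deg_sum (bigD1_ord ord_max) //= mxE unlift_none add0n.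
rewrite (bigD1 v) //= big1 ?addn0 ?mxE ?unlift_none ?liftK ?eqxx // => y.
by rewrite mxE unlift_none liftK => /negPf ->.
Qed.

(** Only the chosen vertex changes its degree, and the new one has degree 1;
    every degree statistic used below is updated through this identity. *)
Lemma sum_deg_attach (V : zmodType) (f : nat -> V) :
  \sum_w f (deg (attach G v) w) =
  \sum_w f (deg G w) + f (deg G v).+1 - f (deg G v) + f 1%N.
Proof.
rewrite (bigD1_ord ord_max) //= deg_attach_new addrC; congr (_ + _).
rewrite (bigD1 v) //= [in RHS](bigD1 v) //= deg_attach_old eqxx addn1.
rewrite addrAC [f (deg G v) + _]addrC addrK addrC; congr (_ + _).
by apply: eq_bigr => w /negPf wv; rewrite deg_attach_old wv addn0.
Qed.

Lemma totdeg_attach : totdeg (attach G v) = (totdeg G).+2.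
Proof.
rewrite /totdeg (bigD1_ord ord_max) //= deg_attach_new.
rewrite (bigD1 v) //= [in RHS](bigD1 v) //= deg_attach_old eqxx addn1.
congr (_.+2); congr (_ + _)%N.
by apply: eq_bigr => w /negPf wv; rewrite deg_attach_old wv addn0.
Qed.

End Attach.

Lemma unlabel_eqP n (G H : graph n) :
  unlabel G = unlabel H ->
  exists s : 'S_n, forall x y, H (s x) (s y) = G x y.
Proof.
move=> e; have : H \in unlabel H.
  rewrite inE; apply/existsP; exists 1%g.
  by apply/forallP => x; apply/forallP => y; rewrite !perm1.
rewrite -e inE => /existsP[s /forallP Hs]; exists s => x y.
by have /forallP/(_ y)/eqP := Hs x.
Qed.

Lemma iso_trans n (G H K : graph n) : iso G H -> iso H K -> iso G K.
Proof.
move=> /existsP[s /forallP Hs] /existsP[t /forallP Ht].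
apply/existsP; exists (s * t)%g; apply/forallP => x; apply/forallP => y.
by rewrite !permM (eqP (forallP (Ht _) _)) (eqP (forallP (Hs _) _)).
Qed.

Lemma iso_sym n (G H : graph n) : iso G H -> iso H G.
Proof.
move=> /existsP[s /forallP Hs].
apply/existsP; exists s^-1%g; apply/forallP => x; apply/forallP => y.
by have := eqP (forallP (Hs (s^-1 x)%g) (s^-1 y)%g); rewrite !permKV => ->.
Qed.

Lemma perm_unlabel n (G H : graph n) (s : 'S_n) :
  (forall x y, H (s x) (s y) = G x y) -> unlabel G = unlabel H.
Proof.
move=> Hs; have GH : iso G H.
  apply/existsP; exists s; apply/forallP => x; apply/forallP => y.
  by rewrite /adj Hs.
apply/setP => K; rewrite !inE; apply/idP/idP.
  exact: (iso_trans (iso_sym GH)).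
exact: iso_trans GH.
Qed.

Lemma deg_perm n (G H : graph n) (s : 'S_n) :
  (forall x y, H (s x) (s y) = G x y) -> forall v, deg H (s v) = deg G v.
Proof.
move=> Hs v; rewrite !deg_sum (reindex_inj (@perm_inj _ s)) /=.
by apply: eq_bigr => w _; rewrite Hs.
Qed.

Lemma unlabel_attach n (G H : graph n) (s : 'S_n) :
  (forall x y, H (s x) (s y) = G x y) ->
  forall v, unlabel (attach G v) = unlabel (attach H (s v)).
Proof.
move=> Hs v; apply: (@perm_unlabel _ _ _ (lift_perm ord_max ord_max s)) => x y.
case: (unliftP ord_max x) => [x'|] ->; case: (unliftP ord_max y) => [y'|] ->;
  by rewrite ?lift_perm_lift ?lift_perm_id !mxE ?liftK ?unlift_none ?Hs
             ?(inj_eq perm_inj).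
Qed.

Lemma totdeg_perm n (G H : graph n) (s : 'S_n) :
  (forall x y, H (s x) (s y) = G x y) -> totdeg H = totdeg G.
Proof.
move=> Hs; rewrite /totdeg (reindex_inj (@perm_inj _ s)) /=.
by apply: eq_bigr => v _; rewrite (deg_perm Hs).
Qed.

(** * The attachment step as an averaging operator *)

Lemma sum_neq0 (V : nmodType) (I : finType) (P : pred I) (F : I -> V) :
  \sum_(i | P i) F i != 0 -> exists2 i, P i & F i != 0.
Proof.
move=> s0; case: (pickP [pred i | P i && (F i != 0)]) => [i /andP[]|F0].
  by exists i.
case/eqP: s0; rewrite big1 // => i Pi; apply/eqP.
by have := F0 i; rewrite /= Pi => /negbFE.
Qed.

Section Step.
Variable R : realType.

(** The Markov operator of one step: weighting the choices of the attachment
    vertex is easier to compute with than summing over the resulting graphs. *)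
Definition avg n (G : graph n) (f : graph n.+1 -> R) : R :=
  \sum_v (deg G v)%:R / (totdeg G)%:R * f (attach G v).

Lemma pa_stepE n (G : graph n) (f : graph n.+1 -> R) :
  \sum_H pa_step R G H * f H = avg G f.
Proof.
rewrite /avg (partition_big (attach G) xpredT) //=.
apply: eq_bigr => H _; rewrite /pa_step big_distrl /=.
by apply: eq_bigr => v /eqP ->.
Qed.

Lemma pa_step_ge0 n (G : graph n) H : 0 <= pa_step R G H.
Proof. by apply: sumr_ge0 => v _; rewrite divr_ge0 ?ler0n. Qed.

Lemma avg_le n (G : graph n) (f g : graph n.+1 -> R) :
  (forall H, f H <= g H) -> avg G f <= avg G g.
Proof.
by move=> fg; apply: ler_sum => v _; rewrite ler_wpM2l ?divr_ge0 ?ler0n.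
Qed.

Lemma avg_cst n (G : graph n) (c : R) : (0 < totdeg G)%N -> avg G (fun=> c) = c.
Proof.
move=> D0; rewrite /avg -!mulr_suml -raddf_sum /= -/(totdeg G) divff ?mul1r //.
by rewrite pnatr_eq0 -lt0n.
Qed.

Lemma avg_itv n (G : graph n) (f : graph n.+1 -> R) :
  (forall H, 0 <= f H <= 1) -> 0 <= avg G f <= 1.
Proof.
move=> f01; apply/andP; split.
  apply: sumr_ge0 => v _; rewrite mulr_ge0 ?divr_ge0 ?ler0n //.
  by case/andP: (f01 (attach G v)).
have [D0|] := posnP (totdeg G).
  by rewrite /avg D0 big1 // => v _; rewrite invr0 mulr0 mul0r.
move=> /(avg_cst 1) e1; rewrite -[leRHS]e1; apply: avg_le => H.
by case/andP: (f01 H).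
Qed.

(** An isomorphism carries the attachment step from one graph to the other, so
    the step is a Markov kernel on unlabeled graphs. *)
Lemma avg_unlabel n (G H : graph n) (f : graph n.+1 -> R) :
  (forall K L, unlabel K = unlabel L -> f K = f L) ->
  unlabel G = unlabel H -> avg G f = avg H f.
Proof.
move=> finv /unlabel_eqP[s Hs]; rewrite /avg [RHS](reindex_inj (@perm_inj _ s)).
rewrite (totdeg_perm Hs); apply: eq_bigr => v _.
by rewrite (deg_perm Hs) (finv _ _ (unlabel_attach Hs v)).
Qed.

Definition expect m (S : graph m) n (f : graph n -> R) : R :=
  \sum_T lPA R S T * f T.

Lemma lPA_ge0 m (S : graph m) n (T : graph n) : 0 <= lPA R S T.
Proof.
elim: n T => [|n IH] T /=; first exact: ler0n.
case: ifP => _; last exact: ler0n.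
by apply: sumr_ge0 => T' _; rewrite mulr_ge0 ?pa_step_ge0.
Qed.

Lemma lPA_self m (S T : graph m) : lPA R S T = (T == S)%:R.
Proof. by case: m S T => [|m] S T; rewrite /= ?ltnn eq_Tagged. Qed.

Lemma expect_self m (S : graph m) f : expect S f = f S.
Proof.
rewrite /expect (bigD1 S) //= lPA_self eqxx mul1r big1 ?addr0 // => T /negPf TS.
by rewrite lPA_self TS mul0r.
Qed.

Lemma expect_succ m (S : graph m) n (f : graph n.+1 -> R) : (m <= n)%N ->
  expect S f = expect S (fun G : graph n => avg G f).
Proof.
move=> mn; rewrite /expect /= mn.
under eq_bigr do rewrite big_distrl /=.
rewrite exchange_big; apply: eq_bigr => T _ /=.
by rewrite -pa_stepE big_distrr /=; apply: eq_bigr => H _; rewrite mulrA.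
Qed.

(** Induction over the graphs that occur with positive probability. *)
Lemma lPA_ind (Q : forall n, graph n -> Prop) m (S : graph m) : Q m S ->
  (forall n (G : graph n) v, Q n G -> (0 < deg G v)%N -> Q n.+1 (attach G v)) ->
  forall n (T : graph n), lPA R S T != 0 -> Q n T.
Proof.
move=> QS Qa.
have tagQ n (T : graph n) :
    (Tagged graph T == Tagged graph S)%:R != 0 :> R -> Q n T.
  rewrite pnatr_eq0 eqb0 negbK => /eqP e.
  by have : Q (tag (Tagged graph T)) (tagged (Tagged graph T)) by rewrite e.
elim=> [|n IH] T /=; first exact: tagQ.
case: ifP => _; last exact: tagQ.
move=> /sum_neq0[T' _]; rewrite mulf_eq0 negb_or => /andP[/IH QT'].
move=> /sum_neq0[v /eqP <-].
rewrite mulf_eq0 negb_or pnatr_eq0 -lt0n => /andP[v0 _].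
exact: Qa.
Qed.

Lemma lPA_attach_gt0 m (S : graph m) n (G : graph n) v : (m <= n)%N ->
  0 < lPA R S G -> (0 < deg G v)%N -> 0 < lPA R S (attach G v).
Proof.
move=> mn SG v0 /=; rewrite mn (bigD1 G) //=; apply: ltr_wpDr.
  by apply: sumr_ge0 => T _; rewrite mulr_ge0 ?lPA_ge0 ?pa_step_ge0.
rewrite mulr_gt0 // /pa_step (bigD1 v) //=; apply: ltr_wpDr.
  by apply: sumr_ge0 => w _; rewrite divr_ge0 ?ler0n.
by rewrite divr_gt0 // ltr0n // (bigD1 v) //= ltn_addr.
Qed.

End Step.

(** * The martingale of squared degrees *)

(** Closes the side conditions of [field] when every denominator is a sum or
    product of positive terms. *)
Ltac field_pos :=
  field; do ?[apply/andP; split]; apply: lt0r_neq0; lra.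

Section Martingale.
Variable R : realType.

Definition degpow k n (G : graph n) : R := \sum_v (deg G v)%:R ^+ k.

Lemma degpow_ge0 k n (G : graph n) : 0 <= degpow k G.
Proof. by apply: sumr_ge0 => v _; rewrite exprn_ge0. Qed.

Lemma degpow_attach k n (G : graph n) v :
  degpow k (attach G v) =
  degpow k G + (1 + (deg G v)%:R) ^+ k - (deg G v)%:R ^+ k + 1.
Proof.
rewrite /degpow (sum_deg_attach G v (fun d => d%:R ^+ k)) expr1n.
by rewrite -[in LHS]nat1r.
Qed.

Lemma totdegE n (G : graph n) : (totdeg G)%:R = degpow 1 G.
Proof. by rewrite raddf_sum. Qed.

(** After one step the statistics of interest are quadratic in the degree of
    the chosen vertex; choosing it with probability proportional to the degree
    shifts every power sum by one. *)
Lemma avg_quadratic n (G : graph n) (f : graph n.+1 -> R) a b c :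
  (0 < totdeg G)%N ->
  (forall v, f (attach G v) = a + b * (deg G v)%:R + c * (deg G v)%:R ^+ 2) ->
  avg G f = a + (b * degpow 2 G + c * degpow 3 G) / degpow 1 G.
Proof.
move=> D0 fE; rewrite -{1}(avg_cst a D0) /avg -totdegE.
under eq_bigr do rewrite fE.
rewrite mulrDl mulrAC [c * _ / _]mulrAC /degpow !mulr_sumr -!big_split /=.
by apply: eq_bigr => v _; ring.
Qed.

(** The sum 2 / D + 2 / (D - 2) + ...; the total degree grows by 2 at each
    step, so this is the compensator of Y / D written as a function of the
    graph alone, without reference to time. *)
Fixpoint harmonic_sum (D : nat) : R :=
  if D is D'.+2 then harmonic_sum D' + 2 / D%:R else 0.

(** The constant [c] is there to center the martingale at a given seed. *)
Definition mart c n (G : graph n) : R :=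
  degpow 2 G / degpow 1 G - harmonic_sum (totdeg G) - c.

Lemma mart_attach c n (G : graph n) v : (0 < totdeg G)%N ->
  mart c (attach G v) = mart c G +
    (2 * (deg G v)%:R - 2 * degpow 2 G / degpow 1 G) / (degpow 1 G + 2).
Proof.
move=> D0; rewrite /mart totdeg_attach /= !degpow_attach -!natr1 totdegE.
have : 0 < degpow 1 G by rewrite -totdegE ltr0n.
move: (degpow 1 G) (degpow 2 G) => D Y D_gt0.
by field_pos.
Qed.

Lemma avg_mart c n (G : graph n) : (0 < totdeg G)%N ->
  avg G (mart c (n := n.+1)) = mart c G.
Proof.
move=> D0; have D_gt0 : 0 < degpow 1 G by rewrite -totdegE ltr0n.
rewrite (@avg_quadratic _ _ _
  (mart c G - 2 * degpow 2 G / degpow 1 G / (degpow 1 G + 2))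
  (2 / (degpow 1 G + 2)) 0 D0); first by field_pos.
by move=> v; rewrite mart_attach //; field_pos.
Qed.

(** The second term is a multiple of the sum of d (d + 1) (d + 2) divided by
    D (D + 2).  Rising factorials have the simplest drift: the mean of the new
    sum is (D + 3) / D times the old one plus 6, so that this term decreases
    in mean by enough to pay for the variance of the next increment of
    [mart], up to an error 24 (1 / (D + 2) - 1 / (D + 4)) which the last term
    telescopes away. *)
Definition potential c n (G : graph n) : R :=
  mart c G ^+ 2
  + 8 * (degpow 3 G + 3 * degpow 2 G + 2 * degpow 1 G)
      / (degpow 1 G * (degpow 1 G + 2))
  + 24 / (degpow 1 G + 2).

Lemma avg_potential c n (G : graph n) : (0 < totdeg G)%N ->
  avg G (potential c (n := n.+1)) <= potential c G.
Proof.
move=> D0; have D_gt0 : 0 < degpow 1 G by rewrite -totdegE ltr0n.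
have C0 := degpow_ge0 3 G; have Y0 := degpow_ge0 2 G.
pose k := mart c G - 2 * degpow 2 G / degpow 1 G / (degpow 1 G + 2).
pose l := 2 / (degpow 1 G + 2).
pose q := 8 / ((degpow 1 G + 2) * (degpow 1 G + 4)).
(* The new value of mart is k + l d; the new potential is expanded in d. *)
rewrite (@avg_quadratic _ _ _
  (k ^+ 2 + 24 / (degpow 1 G + 4) +
     q * (degpow 3 G + 3 * degpow 2 G + 2 * degpow 1 G + 12))
  (2 * k * l + 9 * q) (l ^+ 2 + 3 * q) D0); last first.
  move=> v; rewrite /potential mart_attach // !degpow_attach /k /l /q.
  by field_pos.
rewrite -subr_ge0 /potential /k /l /q.
move: D_gt0 C0 Y0; move: (degpow 1 G) (degpow 2 G) (degpow 3 G) (mart c G).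
move=> D Y C m D_gt0 C0 Y0.
(* The loss in one step.  The three terms are: what the rising factorials
   exceed the cubes by, the slack between the coefficient 8 and the variance,
   and the squared mean that the variance subtracts. *)
rewrite [leRHS](_ : _ = 8 * (3 * Y + 2 * D) / (D * (D + 2) * (D + 4))
   + 4 * C / ((D + 2) ^+ 2 * (D + 4)) + 4 * Y ^+ 2 / (D ^+ 2 * (D + 2) ^+ 2)).
  by rewrite !addr_ge0 // divr_ge0 // ?mulr_ge0 ?exprn_ge0 //; lra.
by field_pos.
Qed.

Lemma mart_le_potential c n (G : graph n) : mart c G ^+ 2 <= potential c G.
Proof.
have C0 := degpow_ge0 3 G; have Y0 := degpow_ge0 2 G.
have D0 := degpow_ge0 1 G.
rewrite /potential -addrA lerDl addr_ge0 // divr_ge0 // ?mulr_ge0 //; lra.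
Qed.

Lemma totdeg_lPA m (S : graph m) n (T : graph n) :
  (0 < totdeg S)%N -> lPA R S T != 0 -> (0 < totdeg T)%N.
Proof.
move=> DS; move: n T.
apply: (@lPA_ind R (fun n (G : graph n) => 0 < totdeg G)%N) => // n G v _ _.
by rewrite totdeg_attach.
Qed.

Lemma expect_le m (S : graph m) n (f g : graph n -> R) : (0 < totdeg S)%N ->
  (forall G, (0 < totdeg G)%N -> f G <= g G) -> expect S f <= expect S g.
Proof.
move=> DS fg; apply: ler_sum => T _.
have [->|T0] := eqVneq (lPA R S T) 0; first by rewrite !mul0r.
by rewrite ler_wpM2l ?lPA_ge0 ?fg // (totdeg_lPA DS T0).
Qed.

Lemma eq_expect m (S : graph m) n (f g : graph n -> R) : (0 < totdeg S)%N ->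
  (forall G, (0 < totdeg G)%N -> f G = g G) -> expect S f = expect S g.
Proof.
by move=> DS fg; apply/le_anti/andP; split; apply: expect_le => // G /fg ->.
Qed.

Lemma expect_mart c m (S : graph m) n : (0 < totdeg S)%N -> (m <= n)%N ->
  expect S (mart c (n := n)) = mart c S.
Proof.
move=> DS /subnKC <-; elim: (n - m)%N => [|k IH].
  by rewrite addn0 expect_self.
rewrite addnS expect_succ ?leq_addr // -IH.
by apply: eq_expect => // G; exact: avg_mart.
Qed.

Lemma expect_mart_sqr c m (S : graph m) n : (0 < totdeg S)%N -> (m <= n)%N ->
  expect S (fun T : graph n => mart c T ^+ 2) <= potential c S.
Proof.
move=> DS mn; apply: (@le_trans _ _ (expect S (potential c (n := n)))).
  by apply: expect_le => // G _; exact: mart_le_potential.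
move: mn => /subnKC <-; elim: (n - m)%N => [|k IH].
  by rewrite addn0 expect_self.
rewrite addnS expect_succ ?leq_addr // (le_trans _ IH) //.
by apply: expect_le => // G; exact: avg_potential.
Qed.

Lemma mart_unlabel c n (G H : graph n) :
  unlabel G = unlabel H -> mart c G = mart c H.
Proof.
move=> /unlabel_eqP[s Hs].
have powE k : degpow k H = degpow k G.
  rewrite /degpow (reindex_inj (@perm_inj _ s)) /=.
  by apply: eq_bigr => v _; rewrite (deg_perm Hs).
by rewrite /mart !powE (totdeg_perm Hs).
Qed.

Lemma mart_attach_inj c n (G : graph n) v w : (0 < totdeg G)%N ->
  mart c (attach G v) = mart c (attach G w) -> deg G v = deg G w.
Proof.
move=> D0; rewrite !mart_attach // => /addrI /divIf -/(_ _)/addIr e.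
have : 0 < degpow 1 G by rewrite -totdegE ltr0n.
move=> D_gt0; apply/eqP; rewrite -(eqr_nat R); apply/eqP.
by apply: (@mulfI _ 2); rewrite ?e // lt0r_neq0 //; lra.
Qed.

End Martingale.

(** * Total variation and test functions *)

Section TotalVariation.
Variables (R : realType) (T : finType).
Implicit Types P Q : T -> R.

Lemma prob_le_TV P Q (A : {set T}) : `|prob P A - prob Q A| <= TV P Q.
Proof. exact: (le_bigmax_cond 0 (fun A => `|prob P A - prob Q A|)). Qed.

Lemma TVC P Q : TV P Q = TV Q P.
Proof. by apply: eq_bigr => A _; rewrite distrC. Qed.

Lemma pos_part_le_TV P Q : \sum_(x | Q x <= P x) (P x - Q x) <= TV P Q.
Proof.
apply: le_trans (prob_le_TV P Q [set x | Q x <= P x]).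
rewrite /prob -sumrB; under [in leRHS]eq_bigl do rewrite inE.
exact: ler_norm.
Qed.

Lemma test_le_TV P Q (f : T -> R) : (forall x, 0 <= f x <= 1) ->
  `|\sum_x P x * f x - \sum_x Q x * f x| <= TV P Q.
Proof.
move=> f01.
have half P' Q' : \sum_x P' x * f x - \sum_x Q' x * f x <= TV P' Q'.
  apply: le_trans (pos_part_le_TV P' Q').
  rewrite -sumrB [leRHS]big_mkcond /=; apply: ler_sum => x _.
  have /andP[f0 f1] := f01 x.
  by case: ifP => [PQ|/negbT]; [|rewrite -ltNge => PQ]; nra.
by rewrite ler_norml half lerNl opprB TVC half.
Qed.

Lemma l1_le_TV P Q : \sum_x `|P x - Q x| <= 2 * TV P Q.
Proof.
rewrite (bigID (fun x => Q x <= P x)) /= mulr2n mulrDl !mul1r lerD //.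
  under eq_bigr => x PQ do rewrite ger0_norm ?subr_ge0 //.
  exact: pos_part_le_TV.
rewrite TVC; apply: le_trans (pos_part_le_TV Q P).
rewrite big_mkcond [leRHS]big_mkcond; apply: ler_sum => x _ /=.
rewrite -ltNge; case: ltP => PQ.
  by rewrite (ltW PQ) distrC ger0_norm // subr_ge0 ltW.
by case: ifP => // QP; rewrite subr_ge0.
Qed.

(** A test function need not be bounded to detect a difference between two
    laws; bounded second moments suffice, since |w| <= l + w^2 / (4 l) trades
    the integral of |w| against |P - Q| for l times the L^1 distance plus
    b / (4 l).  The choice l = b / (2 a) makes the last term a / 2, half of
    the gap [a]. *)
Lemma second_moment_le_TV P Q (w : T -> R) (a b : R) :
  (forall x, 0 <= P x) -> (forall x, 0 <= Q x) -> 0 < a -> 0 < b ->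
  a <= \sum_x P x * w x - \sum_x Q x * w x ->
  \sum_x P x * w x ^+ 2 + \sum_x Q x * w x ^+ 2 <= b ->
  a ^+ 2 / (2 * b) <= TV P Q.
Proof.
move=> P0 Q0 a0 b0 aw wb; pose l := b / (2 * a).
have l0 : 0 < l by rewrite divr_gt0 // mulr_gt0.
have split_w x : P x * w x - Q x * w x <=
    l * `|P x - Q x| + (P x * w x ^+ 2 + Q x * w x ^+ 2) / (4 * l).
  have wl : `|w x| <= l + w x ^+ 2 / (4 * l).
    rewrite -subr_ge0 [leRHS](_ : _ = (`|w x| - 2 * l) ^+ 2 / (4 * l)).
      by rewrite divr_ge0 ?sqr_ge0 //; lra.
    by rewrite -[w x ^+ 2]real_normK ?num_real //; field; lra.
  have PQ : `|P x - Q x| <= P x + Q x.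
    by rewrite (le_trans (ler_normB _ _)) // !ger0_norm.
  have w2 : 0 <= w x ^+ 2 / (4 * l) by rewrite divr_ge0 ?sqr_ge0 //; lra.
  apply: le_trans (ler_norm _) _; rewrite -mulrBl normrM.
  apply: le_trans (ler_wpM2l (normr_ge0 _) wl) _.
  rewrite mulrDr [l * _]mulrC lerD2l -mulrDl -mulrA.
  exact: ler_wpM2r.
have : a <= l * (2 * TV P Q) + b / (4 * l).
  apply: le_trans aw _; rewrite -sumrB.
  apply: le_trans (ler_sum _ (fun x _ => split_w x)) _.
  rewrite big_split /= -mulr_sumr -mulr_suml big_split /=.
  by rewrite lerD // ?(ler_pM2l l0) ?l1_le_TV // ler_pM2r // invr_gt0; lra.
have -> : l * (2 * TV P Q) + b / (4 * l) = b / a * TV P Q + a / 2.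
  by rewrite /l; field; rewrite !lt0r_neq0.
move=> h; rewrite ler_pdivrMr ?mulr_gt0 //.
have : a / 2 <= b / a * TV P Q by lra.
rewrite -(ler_pM2r a0) [leRHS](_ : _ = b * TV P Q); last by field; lra.
lra.
Qed.

End TotalVariation.

Lemma pushforward_sum (R : realType) (T U : finType) (f : T -> U) (P : T -> R)
    (g : U -> R) :
  \sum_y Defs.pushforward f P y * g y = \sum_x P x * g (f x).
Proof.
rewrite [RHS](partition_big f xpredT) //=; apply: eq_bigr => y _.
rewrite /pushforward /prob big_distrl /=.
by apply: eq_big => x; rewrite ?inE // => /eqP ->.
Qed.

Lemma pushforward_ge0 (R : realType) (T U : finType) (f : T -> U) (P : T -> R) :
  (forall x, 0 <= P x) -> forall y, 0 <= Defs.pushforward f P y.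
Proof. by move=> P0 y; apply: sumr_ge0. Qed.

(** * Laws of pairs of unlabeled graphs *)

Section Pairs.
Variable R : realType.

Definition expect_pair m (G : graph m) n (g : graph n -> graph n -> R) : R :=
  expect G (fun x => expect G (g x)).

Lemma CPA_sum m (S : graph m) t n (g : ugraph n * ugraph n -> R) :
  \sum_u CPA R n t S u * g u =
  expect S (fun G : graph t =>
    expect_pair G (fun x y => g (unlabel x, unlabel y))).
Proof.
rewrite pushforward_sum /lCPA /expect.
under eq_bigr do rewrite big_distrl /=.
rewrite exchange_big; apply: eq_bigr => G _ /=.
rewrite /expect_pair /expect big_distrr /=.
under [RHS]eq_bigr do rewrite !big_distrr /=.
by rewrite pair_bigA; apply: eq_bigr => -[x y] _ /=; ring.
Qed.

Lemma PA2_sum m (S : graph m) n (g : ugraph n * ugraph n -> R) :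
  \sum_u prod_law (PA R n S) (PA R n S) u * g u =
  expect_pair S (fun x y => g (unlabel x, unlabel y)).
Proof.
rewrite /prod_law /expect_pair /expect.
rewrite -(pushforward_sum _ _
  (fun u => \sum_y lPA R S y * g (u, unlabel y))).
under [RHS]eq_bigr => u _.
  rewrite -(pushforward_sum _ _ (fun v => g (u, v))) big_distrr /=.
  over.
by rewrite pair_bigA; apply: eq_bigr => -[x y] _ /=; rewrite mulrA.
Qed.

Lemma expect_pair_mul m (G : graph m) n (f g : graph n -> R) :
  expect_pair G (fun x y => f x * g y) = expect G f * expect G g.
Proof.
rewrite /expect_pair /expect big_distrl /=; apply: eq_bigr => x _.
rewrite -mulrA; congr (_ * _); rewrite mulr_sumr.
by apply: eq_bigr => y _; rewrite mulrCA.
Qed.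

Lemma expect_pair_succ m (G : graph m) n (g : graph n.+1 -> graph n.+1 -> R) :
  (m <= n)%N ->
  expect_pair G g = expect_pair G (fun x y => avg x (fun x' => avg y (g x'))).
Proof.
move=> mn; rewrite /expect_pair expect_succ //.
apply: eq_bigr => x _; congr (_ * _).
rewrite /avg /expect.
under eq_bigr do rewrite -/(expect _ _) expect_succ // /expect mulr_sumr.
rewrite exchange_big; apply: eq_bigr => y _ /=; rewrite mulr_sumr.
by apply: eq_bigr => v _; rewrite mulrCA.
Qed.

Lemma CPA_ge0 m (S : graph m) t n u : 0 <= CPA R n t S u.
Proof.
apply: pushforward_ge0 => T; apply: sumr_ge0 => G _.
by rewrite !mulr_ge0 ?lPA_ge0.
Qed.

Lemma PA2_ge0 m (S : graph m) n u : 0 <= prod_law (PA R n S) (PA R n S) u.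
Proof. by rewrite mulr_ge0 ?pushforward_ge0 // => T; exact: lPA_ge0. Qed.

Lemma prob_test (T : finType) (P : T -> R) A :
  prob P A = \sum_x P x * (x \in A)%:R.
Proof.
rewrite /prob big_mkcond; apply: eq_bigr => x _ /=.
by case: ifP => _; rewrite ?mulr1 ?mulr0.
Qed.

(** A choice of representative; the default is returned only outside the image
    of [unlabel]. *)
Definition repr_graph n (u : ugraph n) : graph n :=
  odflt (const_mx false) [pick G | unlabel G == u].

Lemma repr_graphK n (G : graph n) :
  unlabel (repr_graph (unlabel G)) = unlabel G.
Proof.
by rewrite /repr_graph; case: pickP => [H /eqP //|/(_ G)]; rewrite eqxx.
Qed.

(** The probability of an event at time n + 1 is, under both laws, the mean at
    time n of one function: the probability that two independent steps lead
    into the event.  That function takes values in [0, 1] and depends on the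
    unlabeled pair only. *)
Lemma TV_succ m (S : graph m) t n : (m <= t)%N -> (t <= n)%N ->
  TV (CPA R n.+1 t S) (prod_law (PA R n.+1 S) (PA R n.+1 S)) <=
  TV (CPA R n t S) (prod_law (PA R n S) (PA R n S)).
Proof.
move=> mt tn; apply: bigmax_le => [|A _].
  by apply: le_trans (prob_le_TV _ _ finset.set0).
pose g x y : R := ((unlabel x, unlabel y) \in A)%:R.
pose h (x y : graph n) := avg x (fun x' => avg y (g x')).
pose f u := h (repr_graph u.1) (repr_graph u.2).
have fh x y : f (unlabel x, unlabel y) = h x y.
  rewrite /f /h /= (avg_unlabel _ (repr_graphK x)); last first.
    move=> K L KL; apply: eq_bigr => v _; congr (_ * _).
    by rewrite /g KL.
  apply: eq_bigr => v _; congr (_ * _).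
  by apply: avg_unlabel (repr_graphK y) => K L KL; rewrite /g KL.
rewrite !prob_test CPA_sum PA2_sum.
have -> : expect S (fun G : graph t => expect_pair G g) =
    \sum_u CPA R n t S u * f u.
  rewrite CPA_sum; apply: eq_bigr => G _; congr (_ * _).
  rewrite expect_pair_succ //; apply: eq_bigr => x _; congr (_ * _).
  by apply: eq_bigr => y _; rewrite fh.
have -> : expect_pair S g = \sum_u prod_law (PA R n S) (PA R n S) u * f u.
  rewrite PA2_sum expect_pair_succ ?(leq_trans mt) //.
  apply: eq_bigr => x _; congr (_ * _).
  by apply: eq_bigr => y _; rewrite fh.
apply: test_le_TV => u; apply: avg_itv => x'; apply: avg_itv => y'.
by rewrite /g; case: (_ \in _); rewrite ?lexx ler01.
Qed.

End Pairs.

(** * Vertices of different degrees *)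

Lemma deg_gt0P n (G : graph n) v :
  reflect (exists w, adj G v w) (0 < deg G v)%N.
Proof.
apply: (iffP card_gt0P) => -[w]; first by rewrite inE; exists w.
by move=> vw; exists w; rewrite inE.
Qed.

Lemma deg_gt1P n (G : graph n) v :
  reflect (forall x, exists2 w, adj G v w & w != x) (1 < deg G v)%N.
Proof.
apply: (iffP card_gt1P) => [[a [b [va vb ab]]] x|h].
  rewrite !inE in va vb; have [ax|ax] := eqVneq a x; last by exists a.
  by exists b => //; rewrite -ax eq_sym.
have [a va _] := h v; have [b vb ba] := h a.
by exists a, b; rewrite !inE va vb eq_sym ba.
Qed.

(** If no vertex had degree 1, every path could be prolonged at its starting
    point by a neighbour other than the second vertex: that neighbour is not
    on the path, for it would close a cycle.  Paths of distinct vertices would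
    then be arbitrarily long. *)
Lemma exists_leaf n (G : graph n) (v : 'I_n) : symmetric (adj G) ->
  irreflexive (adj G) ->
  (forall c : seq 'I_n, ucycle (adj G) c -> (size c <= 2)%N) ->
  (0 < deg G v)%N -> exists w, deg G w = 1%N.
Proof.
move=> sym irr acyc v0; case: (pickP [pred w | deg G w == 1%N]) => [w /eqP|no].
  by exists w.
have deg2 w : (0 < deg G w)%N -> (1 < deg G w)%N.
  by move=> w0; rewrite ltn_neqAle eq_sym w0 andbT; exact/negbT/no.
have long k : exists x p, [/\ uniq (x :: p), path (adj G) x p & size p = k.+1].
  elim: k => [|k [x [p [up pp sp]]]].
    have /deg_gt0P[w vw] := v0.
    exists v, [:: w]; split=> //=; last by rewrite vw.
    by rewrite inE andbT; apply/eqP => e; rewrite -e irr in vw.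
  have /deg2/deg_gt1P/(_ (head x p))[z xz zh] : (0 < deg G x)%N.
    apply/deg_gt0P; by case: p pp sp {up} => [|y p] //= /andP[xy _] _; exists y.
  exists z, (x :: p); split; rewrite /= ?sp ?(sym z) ?xz //.
  rewrite -/(uniq (x :: p)) up andbT inE negb_or; apply/andP; split.
    by apply/eqP => e; rewrite -e irr in xz.
  apply/negP => zp; case/splitPr: zp up pp zh {sp} => p1 p2 up pp zh.
  case: p1 up pp zh => [|y p1] up pp /=; first by rewrite eqxx.
  move=> _.
  suff /acyc : ucycle (adj G) (x :: rcons (y :: p1) z) by rewrite /= size_rcons.
  have e : x :: (y :: p1) ++ z :: p2 = (x :: rcons (y :: p1) z) ++ p2.
    by rewrite /= cat_rcons.
  rewrite /ucycle /=; apply/andP; split.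
    move: pp; rewrite /= -cat_rcons cat_path => /and3P[-> pp _] /=.
    by rewrite rcons_path pp last_rcons sym.
  by move: up; rewrite e cat_uniq => /andP[].
have [x [p [/card_uniqP c _ sp]]] := long n.
by have := max_card (mem (x :: p)); rewrite c /= sp card_ord ltnNge leqnSn.
Qed.

(** With all degrees at most 1, a vertex and its neighbour would make up a
    whole connected component. *)
Lemma exists_branch n (G : graph n) : (2 < n)%N ->
  symmetric (adj G) -> (forall x y : 'I_n, connect (adj G) x y) ->
  exists v, (1 < deg G v)%N.
Proof.
move=> n2 sym con; case: (pickP [pred v | 1 < deg G v]%N) => [v|no].
  by exists v.
have uniq_nb x y z : adj G x y -> adj G x z -> z = y.
  move=> xy xz; apply/eqP/negP => /negP zy.
  have /negP := negbT (no x); case; apply/card_gt1P; exists z, y.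
  by rewrite !inE.
pose x : 'I_n := Ordinal (ltn_trans (ltnSn 0) (ltn_trans (ltnSn 1) n2)).
have cl y : adj G x y -> fingraph.closed (adj G) (mem [:: x; y]).
  move=> xy; apply: intro_closed => [|a b ab]; first exact: sym_connect_sym.
  rewrite !inE => /orP[] /eqP ea; rewrite {a}ea in ab.
    by rewrite (uniq_nb _ _ _ xy ab) eqxx orbT.
  by rewrite sym in xy; rewrite (uniq_nb _ _ _ xy ab) eqxx.
(* A vertex without neighbours is covered by taking y = x. *)
have : exists y, [forall a, a \in [:: x; y]].
  case: (pickP (adj G x)) => [y xy|no_nb].
    exists y; apply/forallP => a.
    by rewrite -(closed_connect (cl y xy) (con x a)) inE eqxx.
  exists x; apply/forallP => a; have /connectP[[|b p] /=] := con x a.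
    by move=> _ ->; rewrite inE eqxx.
  by rewrite no_nb.
case=> y /forallP all.
have /fintype.subsetP/subset_leq_card : {subset 'I_n <= [:: x; y]}.
  by move=> a _; exact: all.
rewrite card_ord => /leq_trans/(_ (card_size _)) /=.
by rewrite leqNgt n2.
Qed.

Lemma tree_deg_gt0 n (G : graph n) : (1 < n)%N ->
  (forall x y : 'I_n, connect (adj G) x y) -> exists v, (0 < deg G v)%N.
Proof.
move=> n1 con; pose x : 'I_n := Ordinal (ltn_trans (ltnSn 0) n1).
exists x; apply/deg_gt0P; have /connectP[[|b p] /=] := con x (Ordinal n1).
  by move=> _ /(congr1 val).
by move=> /andP[xb _]; exists b.
Qed.

Section Reach.
Variable R : realType.

Lemma reach m (S : graph m) n : (m <= n)%N -> (exists v, 0 < deg S v)%N ->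
  exists G : graph n, 0 < lPA R S G /\ (exists v, 0 < deg G v)%N.
Proof.
move=> /subnKC <- S0; elim: (n - m)%N => [|k [G [SG [v v0]]]].
  by rewrite addn0; exists S; rewrite lPA_self eqxx ltr01.
rewrite addnS; exists (attach G v); split.
  by rewrite lPA_attach_gt0 ?leq_addr.
by exists ord_max; rewrite deg_attach_new.
Qed.

(** After at least one step the new vertex has degree 1 and the vertex it was
    attached to has degree at least 2.  Only when no step has been made does
    one need the seed itself to have a leaf and a branching vertex. *)
Lemma reach_irregular s (S : graph s) n : is_tree S ->
  (2 <= s)%N -> (s <= n)%N -> (2 < n)%N ->
  exists (G : graph n) v w,
    [/\ 0 < lPA R S G, (0 < deg G v)%N, (0 < deg G w)%N & deg G v <> deg G w].
Proof.
move=> [_ sym irr con acyc] s2 sn n2; have S0 := tree_deg_gt0 s2 con.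
move: sn; rewrite leq_eqVlt => /predU1P[e|]; last first.
  case: n n2 => [|n] // n2; rewrite ltnS => sn.
  have [G [SG [v v0]]] := reach sn S0.
  exists (attach G v), ord_max, (lift ord_max v).
  rewrite deg_attach_new deg_attach_old eqxx addn1; split=> //.
    exact: lPA_attach_gt0.
  by case=> e; rewrite -e in v0.
case: _ / e in n2 *.
have [v v0] := S0; have [w w1] := exists_leaf sym irr acyc v0.
have [u u1] := exists_branch n2 sym con.
exists S, w, u; rewrite lPA_self eqxx ltr01 w1 (ltnW u1); split=> // e.
by rewrite -e in u1.
Qed.

End Reach.

(** * The lower bound and the limit *)

(** The test function is the product of the two values of the martingale,
    centered at its value at the seed.  Its mean is zero for the product law
    and, for the coupled law, the variance of the martingale at the time of
    separation; this is positive because two graphs occurring at that time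
    have different values.  The potential bounds the second moments at all
    later times. *)
Lemma CPA_TV_lower_bound (R : realType) s (S : graph s) t (G H : graph t) :
  (s <= t)%N -> (0 < totdeg S)%N -> 0 < lPA R S G -> 0 < lPA R S H ->
  mart (0 : R) G <> mart 0 H ->
  exists2 e : R, 0 < e & forall n, (t <= n)%N ->
    e <= TV (CPA R n t S) (prod_law (PA R n S) (PA R n S)).
Proof.
move=> st DS SG SH GH; pose c : R := mart 0 S.
pose a := expect S (fun K : graph t => mart c K ^+ 2).
(* The summand 1 only ensures that b is positive. *)
pose b := expect S (fun K : graph t => potential c K ^+ 2)
          + potential c S ^+ 2 + 1.
have martc n (K : graph n) : mart c K = mart 0 K - c by rewrite /mart subr0.
have a_gt0 : 0 < a.
  have pos (K : graph t) : 0 < lPA R S K -> mart c K != 0 -> 0 < a.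
    move=> SK K0; rewrite /a /expect (bigD1 K) //= ltr_wpDr //.
      by apply: sumr_ge0 => T _; rewrite mulr_ge0 ?lPA_ge0 ?sqr_ge0.
    by rewrite mulr_gt0 // exprn_even_gt0.
  have [G0|] := eqVneq (mart c G) 0; last exact: pos.
  apply: (pos H) => //; apply/eqP => H0; apply: GH.
  by move: G0 H0; rewrite !martc => /subr0_eq -> /subr0_eq ->.
have b_gt0 : 0 < b.
  rewrite ltr_wpDl // addr_ge0 ?sqr_ge0 //.
  by apply: sumr_ge0 => T _; rewrite mulr_ge0 ?lPA_ge0 ?sqr_ge0.
exists (a ^+ 2 / (2 * b)) => [|n tn].
  by rewrite divr_gt0 ?exprn_gt0 ?mulr_gt0.
have sn := leq_trans st tn.
pose w (u : ugraph n * ugraph n) : R :=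
  mart c (repr_graph u.1) * mart c (repr_graph u.2).
have wE x y : w (unlabel x, unlabel y) = mart c x * mart c y.
  by rewrite /w /= !(mart_unlabel _ (repr_graphK _)).
have pair_w m (K : graph m) : (0 < totdeg K)%N -> (m <= n)%N ->
    expect_pair K (fun x y => w (unlabel x, unlabel y)) = mart c K ^+ 2.
  move=> DK mn; rewrite expr2 -{1 2}(expect_mart c DK mn) -expect_pair_mul.
  apply: eq_expect => // x _; apply: eq_expect => // y _; exact: wE.
have pair_w2 m (K : graph m) : (0 < totdeg K)%N -> (m <= n)%N ->
    expect_pair K (fun x y => w (unlabel x, unlabel y) ^+ 2)
    <= potential c K ^+ 2.
  move=> DK mn; have := expect_mart_sqr c DK mn => le2.
  apply: (@le_trans _ _ (expect K (fun x : graph n => mart c x ^+ 2) ^+ 2)).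
    rewrite expr2 -expect_pair_mul.
    apply: expect_le => // x _; apply: expect_le => // y _.
    by rewrite wE exprMn.
  rewrite lerXn2r ?nnegrE // ?(le_trans _ le2) //;
  by apply: sumr_ge0 => T _; rewrite mulr_ge0 ?lPA_ge0 ?sqr_ge0.
apply: (second_moment_le_TV (w := w)) => //.
- exact: CPA_ge0.
- exact: PA2_ge0.
- rewrite CPA_sum PA2_sum pair_w // martc subrr expr0n subr0 le_eqVlt.
  by apply/orP; left; apply/eqP/eq_expect => // K DK; rewrite pair_w.
- rewrite (CPA_sum _ _ (fun u => w u ^+ 2)) (PA2_sum _ (fun u => w u ^+ 2)).
  rewrite (le_trans _ (ltW (ltr_pwDr ltr01 (lexx _)))) // lerD ?pair_w2 //.
  by apply: expect_le => // K DK; exact: pair_w2.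
Qed.

Local Open Scope classical_set_scope.

Theorem corollary1p4 (R : realType) (s : nat) (S : graph s) (tstar : nat)
    (S_tree : is_tree S) (s_ge2 : (2 <= s)%N)
    (tstar_gt_s : (s < tstar)%N) (tstar_gt3 : (3 < tstar)%N) :
  cvgn (fun n : nat =>
    TV (CPA R n tstar S) (prod_law (PA R n S) (PA R n S))) /\
  0 < limn (fun n : nat =>
    TV (CPA R n tstar S) (prod_law (PA R n S) (PA R n S))).
Proof.
case: tstar tstar_gt_s tstar_gt3 => [//|t]; rewrite !ltnS => st t2.
have [G [v [w [SG v0 w0 vw]]]] := reach_irregular R S_tree s_ge2 st t2.
have totdeg_gt0 n (K : graph n) x : (0 < deg K x)%N -> (0 < totdeg K)%N.
  by move=> x0; rewrite /totdeg (bigD1 x) //= ltn_addr.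
have DS : (0 < totdeg S)%N.
  by case: S_tree => _ _ _ /(tree_deg_gt0 s_ge2)[x /totdeg_gt0].
have [|e e0 eTV] := CPA_TV_lower_bound (leqW st) DS
    (lPA_attach_gt0 st SG v0) (lPA_attach_gt0 st SG w0).
  by move/(mart_attach_inj (totdeg_gt0 _ _ _ v0)).
set u := fun n => TV _ _.
have cvg_u : cvgn u.
  apply: (near_nonincreasing_is_cvgn (m := e)).
    exists t.+1 => // n /= tn m; elim: m => [|m IH].
      by rewrite leqn0 => /eqP ->.
    rewrite leq_eqVlt => /predU1P[-> //|]; rewrite ltnS => nm.
    apply: le_trans (IH nm); apply: TV_succ; first exact: leqW.
    exact: leq_trans tn nm.
  by exists t.+1.
split=> //; apply: lt_le_trans e0 _; apply: limr_ge => //.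
by exists t.+1.
Qed.
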